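(* Let $n\ge 1$ and $q\ge 2$ be integers. Then $\hat{T}_n^q$ is, up to isomorphism, the unique tree that minimizes the total number of subtrees $F$ among all trees in $\mathscr{A}_n^q$; that is, for every $T\in\mathscr{A}_n^q$ one has $F(T)\ge F(\hat{T}_n^q)$, with equality if and only if $T\cong\hat{T}_n^q$. Moreover, for $q\ge 3$, $$F(\hat{T}_n^q)=\frac{2^{q-2}(2^{q-1}-1)^2(2^{(n-1)(q-2)}-1)}{(2^{q-2}-1)^2}-\frac{n-1}{2^{q-2}-1}+2^q+nq-3n+3.$$
   Context: All graphs are finite and simple. A subtree of a tree $T$ is a (nonempty) connected induced subgraph of $T$; $F(T)$ denotes the total number of subtrees of $T$ (with at least one vertex; subtrees are counted as distinct subgraphs, not up to isomorphism). A leaf is a vertex of degree 1. For $q\ge 2$, a (complete) $q$-ary tree is a tree in which every non-leaf vertex has exactly $q$ neighbours. $\mathscr{A}_n^q$ is the class of $q$-ary trees with exactly $n$ non-leaf vertices (hence $(q-2)n+2$ leaves). $\hat{T}_n^q$ is the tree obtained from the path $P_{n+2}$ on $n+2$ vertices by attaching $q-2$ pendant edges to each of the $n$ non-leaf vertices of $P_{n+2}$. *)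

(* Defs.v *)
From HB Require Import structures.
From mathcomp Require Import all_boot all_order all_algebra.

Set Implicit Arguments.
Unset Strict Implicit.
Unset Printing Implicit Defensive.

Record sgraph := SGraph {
  vertex :> finType;
  adj : rel vertex;
  adj_sym : symmetric adj;
  adj_irr : irreflexive adj }.

Definition sgraph_iso (G H : sgraph) : Prop :=
  exists2 f : G -> H, bijective f & forall x y, adj (f x) (f y) = adj x y.

Definition degree (G : sgraph) (x : G) : nat := #|[set y | adj x y]|.

Definition leaf (G : sgraph) (x : G) : bool := degree x == 1.

Definition induced_adj (G : sgraph) (S : {set G}) : rel G :=
  [rel x y | [&& x \in S, y \in S & adj x y]].

(* The subgraph of G induced by S is nonempty and connected. *)
Definition connected_set (G : sgraph) (S : {set G}) : bool :=
  (S != set0) && [forall x in S, forall y in S, connect (induced_adj S) x y].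

(* [ucycle] also accepts [::] and, for adjacent x and y, [:: x; y], so only
   sequences of size at least 3 are genuine graph cycles. *)
Definition acyclic (G : sgraph) : Prop :=
  forall c : seq G, ucycle (@adj G) c -> size c <= 2.

Definition is_tree (G : sgraph) : Prop :=
  connected_set [set: G] /\ acyclic G.

(* A subtree of a tree is an induced subgraph, hence is determined by its
   vertex set. *)
Definition num_subtrees (T : sgraph) : nat :=
  #|[set S : {set T} | connected_set S]|.

Definition qary_tree (q : nat) (T : sgraph) : Prop :=
  is_tree T /\ forall x : T, ~~ leaf x -> degree x = q.

Definition qary_class (n q : nat) (T : sgraph) : Prop :=
  qary_tree q T /\ #|[set x : T | ~~ leaf x]| = n.

(* [inl i] is the i-th vertex of the path P_(n+2), whose non-leaf vertices are
   1, ..., n; the [inr (k, j)], j < q - 2, are the pendant vertices attached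
   to the path vertex k + 1. *)
Definition caterpillar_vertex (n q : nat) : finType :=
  ('I_n.+2 + 'I_n * 'I_(q - 2))%type.

Definition caterpillar_adj (n q : nat) : rel (caterpillar_vertex n q) :=
  fun x y => match x, y with
  | inl i, inl j => (i.+1 == j :> nat) || (j.+1 == i :> nat)
  | inl i, inr (k, _) | inr (k, _), inl i => i == k.+1 :> nat
  | inr _, inr _ => false
  end.

Lemma caterpillar_adj_sym n q : symmetric (@caterpillar_adj n q).
Proof. by move=> [i|[k a]] [j|[l b]] //=; rewrite orbC. Qed.

Lemma caterpillar_adj_irr n q : irreflexive (@caterpillar_adj n q).
Proof. by move=> [i|[k a]] //=; rewrite orbb eqn_leq ltnn. Qed.

Definition caterpillar (n q : nat) : sgraph :=
  SGraph (@caterpillar_adj_sym n q) (@caterpillar_adj_irr n q).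

(* Main.v *)
Require Import Defs.
From HB Require Import structures.
From mathcomp Require Import all_boot all_order all_algebra.
From mathcomp Require Import zify ring.

(** Write d = q - 1.  The bound rests on two facts about rooted trees in which
    every non-leaf has d children.

    (1) Among those with m non-leaves, the number of subtrees through the root
    is smallest for the comb, where each non-leaf has at most one non-leaf
    child.  Writing b_m for one more than this smallest number, b_0 = 2 and
    b_(m+1) = 1 + 2^(d-1) b_m.  A root whose i-th child carries m_i non-leaves
    lies on at least the product of the b_(m_i) subtrees, and
    2 b_(i+j) <= b_i b_j with equality only for i = 0 or j = 0, so it pays to
    put all the non-leaves below a single child ([ary_extremal]).

    (2) An unrooted q-ary tree with n non-leaves has a non-leaf x all of whose
    neighbours but one, say v, are leaves: a root can be pushed towards
    non-leaves until it gets there ([reroot_star]).  Cut the edge xv.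
    The number of subtrees is a constant, for those in the star at x, plus the
    number F(v) of subtrees on the side of v, plus 2^d times the number N(v) of
    those among the latter that contain v, for the subtrees using xv.  Now
    F(v) + N(v) + 1 is the number of subtrees of the smaller q-ary tree in which
    x has become a leaf, so F(v) + N(v) is minimal for the comb by induction on
    n, and N(v) is minimal for the comb by (1).  As 2^d > 1, equality forces
    equality in (1), that is, a comb at v ([star_extremal]), and the whole tree
    is then the caterpillar.

    To make the induction structural, rooted trees are encoded as binary terms
    [ptree], where [Graft s u] hangs u below the root of s.  Every tree
    decomposes along such a term ([realizes_of_tree]); the term determines the
    numbers of subtrees ([realizes_counts]) and the tree up to isomorphism
    ([realizes_iso]); and exchanging siblings or moving the root along an edge
    changes the term but not the tree ([realizes_reroot]). *)


Set Implicit Arguments.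
Unset Strict Implicit.
Unset Printing Implicit Defensive.

(** * Rooted trees as terms *)

(** [Graft s u] is s with u attached as a further child of the root of s. *)
Inductive ptree := Single | Graft of ptree & ptree.

Fixpoint root_degree t := if t is Graft s _ then (root_degree s).+1 else 0.

Fixpoint rooted_subtrees t :=
  if t is Graft s u then rooted_subtrees s * (rooted_subtrees u).+1 else 1.

Fixpoint subtrees t :=
  if t is Graft s u then
    subtrees s + subtrees u + rooted_subtrees s * rooted_subtrees u
  else 1.

Fixpoint inner_below t :=
  if t is Graft s u then
    inner_below s + inner_below u + (root_degree u != 0)
  else 0.

(** [inner_below] leaves the root out, because the number of its children is
    not final while siblings are still being grafted; [inner] is to be used for
    a tree whose root hangs below a parent, hence is a leaf exactly when it has
    no child. *)
Definition inner t := inner_below t + (root_degree t != 0).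

(** The root is unconstrained, so that the terms met while the children of a
    root are grafted one by one still satisfy this. *)
Fixpoint ary_below d t :=
  if t is Graft s u then
    [&& ary_below d s, ary_below d u &
        (root_degree u == 0) || (root_degree u == d)]
  else true.

Definition ary d t :=
  ary_below d t && ((root_degree t == 0) || (root_degree t == d)).

Fixpoint star k := if k is k'.+1 then Graft (star k') Single else Single.

(** The caterpillar without one of its end leaves, rooted next to it. *)
Fixpoint comb d m :=
  if m is m'.+1 then Graft (star d.-1) (comb d m') else Single.

(** Isomorphism of rooted trees, as generated by exchanging siblings. *)
Inductive reorder : ptree -> ptree -> Prop :=
| reorder_refl t : reorder t t
| reorder_trans t u v : reorder t u -> reorder u v -> reorder t v
| reorder_swap s t u : reorder (Graft (Graft s t) u) (Graft (Graft s u) t)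
| reorder_graft s s' t t' :
    reorder s s' -> reorder t t' -> reorder (Graft s t) (Graft s' t').

(** Isomorphism of unrooted trees, as generated by moves: grafting joins two
    rooted trees by an edge, so exchanging the two arguments moves the root to
    the other end of that edge. *)
Inductive reroot : ptree -> ptree -> Prop :=
| reroot_reorder t u : reorder t u -> reroot t u
| reroot_flip s u : reroot (Graft s u) (Graft u s)
| reroot_trans t u v : reroot t u -> reroot u v -> reroot t v.

Lemma reorder_root_degree t u : reorder t u -> root_degree t = root_degree u.
Proof. by elim=> //= [t1 t2 t3 _ -> _ ->|s s' _ _ _ -> _ _]. Qed.

Lemma reorder_rooted_subtrees t u :
  reorder t u -> rooted_subtrees t = rooted_subtrees u.
Proof.
elim=> //= [t1 t2 t3 _ -> _ -> //|s t1 t2|s s' t1 t1' _ -> _ -> //].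
by rewrite mulnAC.
Qed.

Lemma reorder_subtrees t u : reorder t u -> subtrees t = subtrees u.
Proof.
elim=> //= [t1 t2 t3 _ -> _ -> //|s t1 t2|s s' t1 t1' rs -> rt ->].
  by nia.
by rewrite (reorder_rooted_subtrees rs) (reorder_rooted_subtrees rt).
Qed.

Lemma reorder_inner_below t u : reorder t u -> inner_below t = inner_below u.
Proof.
elim=> //= [t1 t2 t3 _ -> _ -> //|s t1 t2|s s' t1 t1' _ -> rt ->]; first by lia.
by rewrite (reorder_root_degree rt).
Qed.

Lemma reorder_ary_below d t u : reorder t u -> ary_below d t = ary_below d u.
Proof.
elim=> //= [t1 t2 t3 _ -> _ -> //|s t1 t2|s s' t1 t1' _ -> rt ->].
  by rewrite -!andbA; do !bool_congr; rewrite andbC -!andbA; do !bool_congr.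
by rewrite (reorder_root_degree rt).
Qed.

Lemma reroot_subtrees t u : reroot t u -> subtrees t = subtrees u.
Proof.
elim=> {t u} [t u|s u|t u v _ -> _ -> //]; first exact: reorder_subtrees.
by rewrite /= mulnC (addnC (subtrees s)).
Qed.

Lemma root_degree_eq0 t : (root_degree t == 0) -> t = Single.
Proof. by case: t. Qed.

Lemma rooted_subtrees_star k : rooted_subtrees (star k) = 2 ^ k.
Proof. by elim: k => //= k ->; rewrite expnSr. Qed.

Lemma subtrees_star k : subtrees (star k) = 2 ^ k + k.
Proof. by elim: k => //= k ->; rewrite rooted_subtrees_star expnS; lia. Qed.

Lemma no_inner_below t : inner_below t = 0 -> t = star (root_degree t).
Proof.
elim: t => //= s IHs u _ /eqP.
rewrite !addn_eq0 => /andP[/andP[/eqP/IHs {1}->]] _.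
by rewrite eqb0 negbK => /root_degree_eq0 ->.
Qed.

(** * Subtrees through the root *)

(** The number of ways to meet a comb with m non-leaves in a subtree that
    contains the parent of its root: in one of its subtrees through the root,
    or not at all. *)
Fixpoint comb_bound d m :=
  if m is m'.+1 then (2 ^ d.-1 * comb_bound d m').+1 else 2.

Lemma comb_rooted_subtrees d m :
  (rooted_subtrees (comb d m)).+1 = comb_bound d m.
Proof. by elim: m => //= m <-; rewrite rooted_subtrees_star. Qed.

Lemma comb_bound_gt1 d m : 1 < comb_bound d m.
Proof. by elim: m => //= m IH; have := expn_gt0 2 d.-1; rewrite orTb; nia. Qed.

Lemma comb_bound_gt2 d m : 0 < m -> 2 < comb_bound d m.
Proof.
case: m => //= m _; have := expn_gt0 2 d.-1; have := comb_bound_gt1 d m.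
by rewrite orTb; nia.
Qed.

(** Both sides grow by the factor 2^(d-1) when i increases, up to the summands
    2 on the left and b_j > 2 on the right; this also makes the inequality
    strict from the first step on. *)
Lemma comb_boundM_lt d i j :
  0 < j -> 2 * comb_bound d (i.+1 + j) < comb_bound d i.+1 * comb_bound d j.
Proof.
move=> /(@comb_bound_gt2 d); rewrite addSn /=.
have: 2 * comb_bound d (i + j) <= comb_bound d i * comb_bound d j.
  case: (posnP j) => [->|j_gt0]; first by rewrite addn0 mulnC.
  elim: i => [|i IH]; first exact: leqnn.
  move: IH (comb_bound_gt2 d j_gt0); rewrite addSn /=.
  move: (comb_bound _ _) (comb_bound _ _) (comb_bound _ _) (2 ^ _) => *; nia.
move: (comb_bound _ _) (comb_bound _ _) (comb_bound _ _) (2 ^ _) => *; nia.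
Qed.

(** Log-superadditivity of b up to normalisation by b_0 = 2: two non-leaf
    children cost more than a single one with the same number of non-leaves. *)
Lemma comb_boundM d i j :
  2 * comb_bound d (i + j) <= comb_bound d i * comb_bound d j
    ?= iff (i == 0) || (j == 0).
Proof.
case: (posnP j) => [->|j_gt0].
  by rewrite addn0 orbT [_ i * _]mulnC; apply/leqif_refl.
rewrite orbF; case: i => [|i]; first exact/leqif_refl.
have lt_M := comb_boundM_lt d i j_gt0.
by split; [apply: ltnW | rewrite ltn_eqF].
Qed.

(** The k-1 factors 2 come from the k-1 children that are leaves when all the
    non-leaves are below one of the k children. *)
Definition root_extremal d t :=
  let bound := 2 ^ (root_degree t).-1 * comb_bound d (inner_below t) in
  bound <= rooted_subtrees t /\
  (rooted_subtrees t = bound ->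
   reorder t (Graft (star (root_degree t).-1) (comb d (inner_below t)))).

Definition extremal d t :=
  comb_bound d (inner t) <= (rooted_subtrees t).+1 /\
  ((rooted_subtrees t).+1 = comb_bound d (inner t) ->
   reorder t (comb d (inner t))).

Lemma extremal_of_root d t : 0 < d ->
  (root_degree t == 0) || (root_degree t == d) ->
  (0 < root_degree t -> root_extremal d t) -> extremal d t.
Proof.
move=> d_gt0 /orP[/root_degree_eq0 -> _ | /eqP rd_t].
  by split=> // _; apply: reorder_refl.
rewrite /root_extremal /extremal /inner rd_t -lt0n d_gt0 addn1 /= ltnS.
by case=> // le_t eq_t; split=> // -[]; apply: eq_t.
Qed.

(** Grafting one more child multiplies the count by a factor at least b_j, with
    j the number of non-leaves of that child, and [comb_boundM] merges this with
    the factor b_i already present.  Equality leaves only two possibilities: the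
    new child is a leaf, or all the previous ones are. *)
Lemma ary_below_root_extremal d t :
  0 < d -> ary_below d t -> 0 < root_degree t -> root_extremal d t.
Proof.
move=> d_gt0; elim: t => //= s IHs u IHu /and3P[/IHs{}IHs /IHu{}IHu ary_u] _.
have [le_u eq_u] := extremal_of_root d_gt0 ary_u IHu.
rewrite /root_extremal /= -addnA -/(inner u).
case: (posnP (root_degree s)) => [/eqP/root_degree_eq0 -> | rd_s].
  rewrite /= !mul1n; split=> // /eq_u ru.
  exact: reorder_graft (reorder_refl _) ru.
have [le_s eq_s] := IHs rd_s.
have [le_b eq_b] := comb_boundM d (inner_below s) (inner u).
move: le_s eq_s le_u eq_u le_b eq_b.
case: (root_degree s) rd_s => //= k _.
set i := inner_below s; set j := inner u.
have b1 := comb_bound_gt1 d i; have b2 := comb_bound_gt1 d j.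
have := expn_gt0 2 k; rewrite orTb expnS.
move: (2 ^ k) => e e_gt0 le_s eq_s le_u eq_u le_b eq_b.
have le1 : e * (2 * comb_bound d (i + j))
           <= e * comb_bound d i * comb_bound d j.
  by rewrite -mulnA leq_mul2l le_b orbT.
have le2 : e * comb_bound d i * comb_bound d j
           <= rooted_subtrees s * comb_bound d j.
  by rewrite leq_mul2r le_s orbT.
have le3 : rooted_subtrees s * comb_bound d j
           <= rooted_subtrees s * (rooted_subtrees u).+1.
  by rewrite leq_mul2l le_u orbT.
rewrite [2 * e]mulnC -mulnA; split; first by lia.
move=> eq_su.
have es : rooted_subtrees s = e * comb_bound d i.
  by apply/eqP; rewrite -(eqn_pmul2r (ltnW b2)); apply/eqP; lia.
have s_gt0 : 0 < rooted_subtrees s by rewrite es muln_gt0 e_gt0 ltnW.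
have eu : (rooted_subtrees u).+1 = comb_bound d j.
  by apply/eqP; rewrite -(eqn_pmul2l s_gt0); apply/eqP; lia.
have /eqP : 2 * comb_bound d (i + j) = comb_bound d i * comb_bound d j.
  by apply/eqP; rewrite -(eqn_pmul2l e_gt0); apply/eqP; lia.
rewrite eq_b => /orP[/eqP i0|/eqP j0].
  (* Without non-leaves below it, the bound for s is attained by a star. *)
  apply: reorder_graft; last by rewrite i0; apply: eq_u.
  by rewrite /= -[Single]/(comb d 0) -i0; apply: eq_s.
apply: reorder_trans (reorder_graft (eq_s es) (eq_u eu)) _.
by rewrite j0 addn0; apply: reorder_swap.
Qed.

Lemma ary_extremal d t : 0 < d -> ary d t -> extremal d t.
Proof.
move=> d_gt0 /andP[below_t root_t]; apply: extremal_of_root => //.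
exact: ary_below_root_extremal.
Qed.

(** * Moving the root *)

Lemma inner_child d s : ary_below d s -> 0 < inner_below s ->
  exists s0 c, reorder s (Graft s0 c) /\ root_degree c = d.
Proof.
elim: s => //= s IHs u _ /and3P[below_s below_u].
case/orP=> [rd_u|/eqP rd_u]; last first.
  by exists s, u; split=> //; apply: reorder_refl.
rewrite (root_degree_eq0 rd_u) /= !addn0 => /(IHs below_s)[s0 [c [rs rd_c]]].
exists (Graft s0 Single), c; split=> //.
apply: reorder_trans (reorder_graft rs (reorder_refl _)) _.
exact: reorder_swap.
Qed.

(** As long as the root has a non-leaf child c besides the part u, make c the
    new root and put the old one, together with u, among its children.  The
    number of non-leaves below c is smaller than before, so this stops, at a
    root whose children other than one are leaves. *)
Lemma reroot_star d s u :
    0 < d -> ary_below d s -> root_degree s = d -> ary d u ->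
  exists2 v, reroot (Graft s u) (Graft (star d) v) &
    ary d v /\ (inner v).+1 = inner s + inner u.
Proof.
move=> d_gt0; have [m] := ubnP (inner_below s); elim: m s u => // m IH s u.
rewrite ltnS => le_m below_s rd_s ary_u.
have rd_s0 : root_degree s != 0 by rewrite rd_s -lt0n.
rewrite [inner s]/inner rd_s0 addn1 addSn.
have [s0|s_gt0] := posnP (inner_below s).
  exists u; last by rewrite s0.
  by rewrite {1}(no_inner_below s0) rd_s; apply/reroot_reorder/reorder_refl.
have [s0 [c [rs rd_c]]] := inner_child below_s s_gt0.
have below_sc : ary_below d (Graft s0 c) by rewrite -(reorder_ary_below d rs).
have rd_sc : (root_degree s0).+1 = d by rewrite -rd_s (reorder_root_degree rs).
have inner_s := reorder_inner_below rs.
have rd_c0 : root_degree c != 0 by rewrite rd_c -lt0n.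
move: below_sc inner_s => /= /and3P[below_s0 below_c _].
rewrite rd_c0 addn1 => inner_s.
have [/andP[below_u rd_u]] := (ary_u).
have [||||v rv [ary_v inner_v]] := IH c (Graft s0 u) => //.
- by apply: leq_trans le_m; rewrite inner_s ltnS leq_addl.
- by rewrite /ary /= below_s0 below_u rd_u rd_sc eqxx.
exists v; last first.
  split=> //; rewrite inner_v inner_s /inner /= rd_c0; lia.
apply: reroot_trans rv; apply: reroot_trans (reroot_flip _ _).
apply: reroot_reorder; apply: reorder_trans (reorder_swap _ _ _).
exact: reorder_graft rs (reorder_refl _).
Qed.

(** Both sides are the caterpillar, rooted at the second vertex of its spine on
    the left and at the first one on the right. *)
Lemma comb_reroot d m : 0 < d ->
  reroot (Graft (star d) (comb d m)) (Graft Single (comb d m.+1)).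
Proof.
case: d => // d _; apply: reroot_trans (reroot_flip _ _).
exact/reroot_reorder/reorder_swap.
Qed.

(** This is the minimality of the caterpillar among q-ary trees, rooted at a
    leaf.  Rerooting brings u to the form of [reroot_star]; cutting there
    leaves a tree with one non-leaf less, to which the induction hypothesis
    applies. *)
Lemma subtrees_lb d m u : 0 < d -> ary d u -> inner u = m ->
  subtrees (Graft Single (comb d m)) <= subtrees (Graft Single u).
Proof.
move=> d_gt0; elim: m u => [|m IH] u ary_u inner_u.
  by case: u ary_u inner_u => //= s u _; rewrite /inner /= addn1.
have [below_u root_u] := andP ary_u.
have rd_u : root_degree u = d.
  by case/orP: root_u => [/root_degree_eq0 u0|/eqP//]; rewrite u0 in inner_u.
have [v rv [ary_v inner_v]] :=
  reroot_star d_gt0 below_u rd_u (isT : ary d Single).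
rewrite -(reroot_subtrees (reroot_flip u Single)) (reroot_subtrees rv).
rewrite -(reroot_subtrees (comb_reroot m d_gt0)).
have /eqP {inner_v} : (inner v).+1 = m.+1 by rewrite inner_v inner_u addn0.
rewrite eqSS => /eqP inner_v; have [le_v _] := ary_extremal d_gt0 ary_v.
rewrite inner_v -comb_rooted_subtrees ltnS in le_v.
move: (IH v ary_v inner_v) => /=.
rewrite rooted_subtrees_star; have := expn_gt0 2 d; rewrite orTb.
move: le_v; move: (2 ^ d) (subtrees _) (subtrees _) (subtrees _).
by move: (rooted_subtrees _) (rooted_subtrees _) => *; nia.
Qed.

(** Here F(v) + N(v) and N(v) are both minimal for the comb, and the left-hand
    side is a constant plus F(v) + 2^d N(v) with 2^d > 1, so that equality
    forces N(v) to be minimal. *)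
Lemma star_extremal d v : 0 < d -> ary d v ->
  subtrees (Graft (star d) (comb d (inner v))) <= subtrees (Graft (star d) v) /\
  (subtrees (Graft (star d) v) = subtrees (Graft (star d) (comb d (inner v))) ->
   reorder v (comb d (inner v))).
Proof.
move=> d_gt0 ary_v; have := subtrees_lb d_gt0 ary_v erefl.
have [le_v eq_v] := ary_extremal d_gt0 ary_v.
rewrite -comb_rooted_subtrees ltnS in le_v eq_v.
have : 1 < 2 ^ d by rewrite -{1}(expn0 2) ltn_exp2l.
move: eq_v le_v; rewrite /= rooted_subtrees_star.
move: (2 ^ d) (subtrees _) (subtrees _) (subtrees _).
move: (rooted_subtrees _) (rooted_subtrees _) => N1 N2 e S1 S2 S3.
move=> eq_v le_v e_gt1 le_S.
split; first by nia.
by move=> eS; apply: eq_v; nia.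
Qed.

(** * Decomposition of graphs along edges *)

(** Connectedness as an induction principle over S, so that connected sets can be
    cut and glued without handling paths. *)
Lemma connected_setP (G : sgraph) (S : {set G}) (a : G) : a \in S ->
  reflect (forall X : {set G}, a \in X ->
             (forall x y,
                x \in X -> x \in S -> y \in S -> adj x y -> y \in X) ->
             S \subset X)
          (connected_set S).
Proof.
move=> aS; apply: (iffP andP) => [[_ /forall_inP conS] X aX X_closed | S_min].
  apply/subsetP => y yS.
  have /connectP[p] := forall_inP (conS a aS) y yS.
  elim: p a aX {aS} => [|z p IHp] x xX /= => [_ -> //|].
  by case/andP=> /and3P[xS zS /(X_closed x z xX xS zS)zX] /(IHp z zX).
split; first by apply/set0Pn; exists a.
have sym_S : connect_sym (induced_adj S).
  by apply: sym_connect_sym => x y; rewrite /induced_adj /= adj_sym andbCA.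
have reach x : x \in S -> connect (induced_adj S) a x.
  have /subsetP sSX : S \subset [set y | connect (induced_adj S) a y].
    apply: S_min => [|y z]; rewrite !inE ?connect0 // => cay yS zS ayz.
    by apply: connect_trans cay (connect1 _); apply/and3P.
  by move/sSX; rewrite inE.
apply/forall_inP => x xS; apply/forall_inP => y yS.
by rewrite (connect_trans _ (reach y yS)) // sym_S reach.
Qed.

Definition edge_join (G : sgraph) (A : {set G}) a (B : {set G}) b : Prop :=
  [/\ [disjoint A & B], a \in A, b \in B &
      {in A & B, forall x y, adj x y = (x == a) && (y == b)}].

(** The subgraph induced by A, rooted at a, decomposes along t.  Working with
    subsets of a fixed graph avoids building a graph for each term. *)
Fixpoint realizes (G : sgraph) t (A : {set G}) a : Prop :=
  if t is Graft s u then
    exists B C b,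
      [/\ A = B :|: C, edge_join B a C b, realizes s B a & realizes u C b]
  else A = [set a].

Lemma edge_join_sym (G : sgraph) (A : {set G}) a (B : {set G}) b :
  edge_join A a B b -> edge_join B b A a.
Proof.
case=> disAB aA bB adjAB; split=> //; first by rewrite disjoint_sym.
by move=> x y xB yA; rewrite adj_sym adjAB // andbC.
Qed.

Lemma realizes_swap (G : sgraph) s t u (A : {set G}) a :
  realizes (Graft (Graft s t) u) A a -> realizes (Graft (Graft s u) t) A a.
Proof.
case=> A' [D [c [-> joinD [B [C [b [defA' [disC aB bC adjC] sB tC]]]] uD]]].
case: joinD; rewrite {A'}defA' => disD aD cD adjD.
have inBC x : x \in B -> x \in B :|: C by rewrite inE => ->.
have disBD : [disjoint B & D] by apply: disjointWl disD; apply: subsetUl.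
have disCD : [disjoint C & D] by apply: disjointWl disD; apply: subsetUr.
exists (B :|: D), C, b; split=> //; first by rewrite setUAC.
  split=> // [|| x y].
  - by rewrite disjoints_subset subUset -!disjoints_subset disC disjoint_sym.
  - by rewrite inE aB.
  rewrite inE => /orP[xB|xD] yC; first exact: adjC.
  rewrite adj_sym adjD ?inE ?yC ?orbT //.
  rewrite (negPf (_ : y != a)); last first.
    by apply: contraTneq yC => ->; rewrite (disjointFr disC).
  rewrite (negPf (_ : x != a)) //.
  by apply: contraTneq xD => ->; rewrite (disjointFr disBD).
exists B, D, c; split=> //; split=> // x y xB yD.
by apply: adjD => //; apply: inBC.
Qed.

Lemma realizes_reorder (G : sgraph) t u (A : {set G}) a :
  reorder t u -> realizes t A a -> realizes u A a.
Proof.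
move=> r; elim: r A a => {t u}
  [//|t u v _ IHt _ IHu|s t u|s s' t t' _ IHs _ IHt] A a.
- by move/IHt/IHu.
- exact: realizes_swap.
by case=> B [C [b [-> AB /IHs sB /IHt tC]]]; exists B, C, b.
Qed.

Lemma realizes_reroot (G : sgraph) t u (A : {set G}) a :
  reroot t u -> realizes t A a -> exists b, realizes u A b.
Proof.
move=> r; elim: r A a => {t u} [t u r|s u|t u v _ IHt _ IHu] A a.
- by move/(realizes_reorder r) => ?; exists a.
- case=> B [C [b [-> AB sB uC]]]; exists b, C, B, a.
  by split=> //; [rewrite setUC|apply: edge_join_sym].
by case/IHt=> b /IHu.
Qed.

(** Split off the component B of a neighbour b of the root a in A minus a.  If a
    had a second neighbour y in B, a path from b to y in B would close up to a
    cycle through a; hence ab is the only edge leaving B.  Both parts are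
    connected and smaller than A. *)
Lemma realizes_of_tree (G : sgraph) (A : {set G}) a :
  acyclic G -> connected_set A -> a \in A -> exists t, realizes t A a.
Proof.
move=> acyG; have [m] := ubnP #|A|; elim: m A a => // m IH A a.
rewrite ltnS => leAm conA aA.
have conAP := elimT (connected_setP aA) conA.
have [/existsP[b /andP[bA adj_ab]]|no_nbr] :=
  boolP [exists b in A, adj a b]; last first.
  exists Single; apply/eqP; rewrite eqEsubset sub1set aA andbT.
  apply: conAP => [|x y]; first exact: set11.
  move/set1P=> -> _ yA ay; case/existsP: no_nbr.
  by exists y; rewrite yA.
have b_neq_a : b != a by apply: contraTneq adj_ab => ->; rewrite adj_irr.
pose e := induced_adj (A :\ a); pose B := [set y | connect e b y].
have bB : b \in B by rewrite inE connect0.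
have sBA : B \subset A :\ a.
  apply/subsetP => y; rewrite inE => /connectP[p].
  case/lastP: p => [_ ->|p z]; first by rewrite !inE b_neq_a.
  by rewrite rcons_path last_rcons => /andP[_ /and3P[_ zA _]] ->.
have B_closed x y : x \in B -> y \in A :\ a -> adj x y -> y \in B.
  move=> xB yA xy; move: (xB); rewrite !inE => /connect_trans; apply.
  by apply: connect1; apply/and3P; rewrite (subsetP sBA).
have aB : a \notin B by apply: contraL isT => /(subsetP sBA); rewrite !inE eqxx.
have subA : B \subset A by apply: subset_trans sBA (subD1set _ _).
have aC : a \in A :\: B by rewrite inE aB.
have joinCB : edge_join (A :\: B) a B b.
  split=> // [|x y /setDP[xA xB] yB].
    by rewrite disjoint_sym disjoints_subset setCD subsetUr.
  apply/idP/andP => [xy|[/eqP-> /eqP->] //].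
  have x_a : x == a.
    apply: contraR xB => x_a; apply: (B_closed y); rewrite ?(adj_sym y) //.
    by rewrite !inE x_a.
  split=> //; move: yB; rewrite inE (eqP x_a) in xy * => /connectP[p0].
  case/shortenP=> p e_p uniq_p _ y_p.
  apply: contraT => y_b.
  have p_in : all [in A :\ a] p.
    by elim: (p) (b) e_p => //= w p' IHp v /andP[/and3P[_ -> _] /IHp].
  have : ucycle (@adj G) [:: a, b & p].
    apply/andP; split; last first.
      rewrite cons_uniq uniq_p andbT inE negb_or eq_sym b_neq_a /=.
      by apply/negP => /(allP p_in); rewrite !inE eqxx.
    rewrite /= adj_ab rcons_path -y_p adj_sym xy andbT.
    by apply: sub_path e_p => u v /and3P[].
  move/acyG; case: p y_p {e_p uniq_p p_in} => //= y_p.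
  by rewrite y_p eqxx in y_b.
have [|||s realizes_s] := IH (A :\: B) a => //.
- apply: leq_trans leAm; apply: proper_card; apply/properP; split.
    exact: subsetDl.
  by exists b => //; rewrite inE bB.
- apply/(connected_setP aC) => X aX X_closed.
  have: A \subset X :|: B.
    apply: conAP => [|x y xXB xA yA xy]; first by rewrite in_setU aX.
    have [->|y_a] := eqVneq y a; first by rewrite in_setU aX.
    have [yB|yB] := boolP (y \in B); first by rewrite in_setU yB orbT.
    have xB : x \notin B.
      by apply: contra yB => xB; apply: B_closed xB _ xy; rewrite in_setD1 y_a.
    rewrite in_setU (X_closed x) ?in_setD ?xB ?yB //.
    by case/setUP: xXB => // xB'; rewrite xB' in xB.
  by move/(setSD B)/subset_trans; apply; rewrite setDUl setDv setU0 subsetDl.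
have [|||u realizes_u] := IH B b => //.
- apply: leq_trans leAm; apply: proper_card; apply/properP; split=> //.
  by exists a.
- apply/(connected_setP bB) => X bX X_closed.
  apply/subsetP => y; rewrite inE => /connectP[p].
  have reach z : z \in X -> z \in B -> path e z p -> last z p \in X.
    elim: p z => //= w p IHp z zX zB /andP[/and3P[_ wA zw]].
    have wB := B_closed z w zB wA zw.
    by apply: IHp => //; apply: X_closed zX zB wB zw.
  by move=> e_p ->; apply: reach.
exists (Graft s u), (A :\: B), B, b; split=> //.
by rewrite setUC setDE setUIr setUCr setIT; apply/esym/setUidPr.
Qed.

(** * Counting subtrees of a decomposed graph *)

Definition subtrees_in (G : sgraph) (A : {set G}) :=
  [set S : {set G} | connected_set S & S \subset A].

Definition subtrees_at (G : sgraph) (A : {set G}) a :=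
  [set S in subtrees_in A | a \in S].

(** A connected set that meets both sides has to use the only edge between
    them; the part on the other side hangs at that edge, so that removing it
    does not disconnect anything. *)
Lemma connected_edge_join (G : sgraph) (A B S T : {set G}) a b :
    edge_join A a B b -> S \subset A -> T \subset B -> S != set0 -> T != set0 ->
  connected_set (S :|: T) =
    [&& a \in S, b \in T, connected_set S & connected_set T].
Proof.
move=> joinAB; have suff_con A' a' B' b' (S' T' : {set G}) :
    edge_join A' a' B' b' -> S' \subset A' -> T' \subset B' -> T' != set0 ->
    S' != set0 -> connected_set (S' :|: T') ->
    a' \in S' /\ connected_set S'.
  case=> disAB aA bB adjAB sSA sTB /set0Pn[y yT] /set0Pn[x xS] conST.
  have xST : x \in S' :|: T' by rewrite inE xS.
  have aS : a' \in S'.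
    apply: contraT => aS.
    have: S' :|: T' \subset S'.
      apply: (elimT (connected_setP xST) conST) => // v w vS _.
      case/setUP=> // wT; rewrite adjAB ?(subsetP sSA) ?(subsetP sTB) //.
      by case/andP=> /eqP va; rewrite -va vS in aS.
    move/subsetP/(_ y); rewrite inE yT orbT => /(_ isT)/(subsetP sSA).
    by rewrite (disjointFl disAB) // (subsetP sTB).
  split=> //; apply/(connected_setP aS) => X aX X_closed.
  have aST : a' \in S' :|: T' by rewrite inE aS.
  have sST : S' :|: T' \subset X :|: T'.
    apply: (elimT (connected_setP aST) conST) => [|v w].
      by rewrite inE aX.
    have [wT _ _ _ _|wT] := boolP (w \in T'); first by rewrite inE wT orbT.
    rewrite !inE (negPf wT) !orbF => vXT vST wS vw.
    have [vT|vT] := boolP (v \in T').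
      move: vw; rewrite adj_sym adjAB ?(subsetP sSA) ?(subsetP sTB) //.
      by case/andP=> /eqP->.
    rewrite (negPf vT) !orbF in vXT vST.
    exact: X_closed vXT vST wS vw.
  apply/subsetP => v vS; have := subsetP sST v; rewrite !inE vS => /(_ isT).
  case/orP=> // /(subsetP sTB); rewrite (disjointFr disAB) //.
  exact: (subsetP sSA).
move=> sSA sTB S0 T0; apply/idP/and4P => [conST|[aS bT conS conT]].
  have [-> ->] := suff_con _ _ _ _ _ _ joinAB sSA sTB T0 S0 conST.
  rewrite setUC in conST.
  have joinBA := edge_join_sym joinAB.
  by have [-> ->] := suff_con _ _ _ _ _ _ joinBA sTB sSA S0 T0 conST.
have aST : a \in S :|: T by rewrite inE aS.
case: joinAB => _ aA bB adjAB.
apply/(connected_setP aST) => X aX X_closed.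
have sSX : S \subset X.
  apply: (elimT (connected_setP aS) conS) => // x y xX xS yS.
  by apply: X_closed; rewrite ?inE ?xS ?yS.
have bX : b \in X.
  by apply: X_closed aX _ _ _; rewrite ?inE ?aS ?bT ?orbT // adjAB // !eqxx.
rewrite subUset sSX; apply: (elimT (connected_setP bT) conT) => // x y xX xT yT.
by apply: X_closed; rewrite ?inE ?xT ?yT ?orbT.
Qed.

Lemma connected_set_neq0 (G : sgraph) (S : {set G}) :
  connected_set S -> S != set0.
Proof. by case/andP. Qed.

Definition crossing_subtrees (G : sgraph) (A B : {set G}) a b :=
  [set p.1 :|: p.2 | p in setX (subtrees_at A a) (subtrees_at B b)].

Lemma card_crossing_subtrees (G : sgraph) (A B : {set G}) a b :
  [disjoint A & B] ->
  #|crossing_subtrees A B a b| = #|subtrees_at A a| * #|subtrees_at B b|.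
Proof.
move=> disAB; rewrite -cardsX; apply: card_in_imset => -[S T] [S' T'].
rewrite !inE /= => /andP[/andP[/andP[_ SA] _] /andP[/andP[_ TB] _]].
move=> /andP[/andP[/andP[_ SA'] _] /andP[/andP[_ TB'] _]] eqST.
have capA (X Y : {set G}) : X \subset A -> Y \subset B ->
    (X :|: Y) :&: A = X /\ (X :|: Y) :&: B = Y.
  move=> XA YB; rewrite !setIUl (setIidPl XA) (setIidPl YB).
  have -> : Y :&: A = set0.
    by apply: disjoint_setI0; rewrite disjoint_sym (disjointWr YB).
  have -> : X :&: B = set0 by apply: disjoint_setI0; apply: disjointWl disAB.
  by rewrite setU0 set0U.
have [[eS eT] [eS' eT']] := (capA _ _ SA TB, capA _ _ SA' TB').
by congr (_, _); [rewrite -eS -eS' eqST | rewrite -eT -eT' eqST].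
Qed.

Lemma mem_subtrees_join (G : sgraph) (A B S : {set G}) a b :
  edge_join A a B b ->
  (S \in subtrees_in (A :|: B)) =
  [|| S \in subtrees_in A, S \in subtrees_in B
    | S \in crossing_subtrees A B a b].
Proof.
move=> joinAB; rewrite ![S \in subtrees_in _]inE; apply/idP/or3P => [|[]].
- case/andP=> conS sSAB.
  have defS : S = (S :&: A) :|: (S :&: B) by rewrite -setIUr (setIidPl sSAB).
  have [SA0|SA0] := eqVneq (S :&: A) set0.
    by constructor 2; rewrite conS defS SA0 set0U subsetIr.
  have [SB0|SB0] := eqVneq (S :&: B) set0.
    by constructor 1; rewrite conS defS SB0 setU0 subsetIr.
  move: (conS); rewrite {1}defS (connected_edge_join joinAB) ?subsetIr //.
  case/and4P=> aS bS conA conB; constructor 3; apply/imsetP.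
  exists (S :&: A, S :&: B) => //.
  by rewrite !inE /= conA conB !subsetIr; move: aS bS; rewrite !inE => -> ->.
- by case/andP=> -> sSA; rewrite (subset_trans sSA) ?subsetUl.
- by case/andP=> -> sSB; rewrite (subset_trans sSB) ?subsetUr.
case/imsetP=> -[S1 S2]; rewrite !inE /=.
case/andP=> /andP[/andP[con1 s1] aS] /andP[/andP[con2 s2] bS] ->.
rewrite (connected_edge_join joinAB) ?connected_set_neq0 //.
by rewrite aS bS con1 con2 setUSS.
Qed.

Lemma card_subtrees_join (G : sgraph) (A B : {set G}) a b : edge_join A a B b ->
  #|subtrees_in (A :|: B)| =
    #|subtrees_in A| + #|subtrees_in B|
      + #|subtrees_at A a| * #|subtrees_at B b|
  /\ #|subtrees_at (A :|: B) a| = #|subtrees_at A a| * #|subtrees_at B b|.+1.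
Proof.
move=> joinAB; have [disAB aA bB _] := joinAB.
rewrite mulnS -!(card_crossing_subtrees _ _ disAB).
have cross S : S \in crossing_subtrees A B a b -> a \in S /\ b \in S.
  case/imsetP=> -[S1 S2]; rewrite !inE /= => /andP[/andP[_ aS] /andP[_ bS]] ->.
  by rewrite !inE aS bS orbT.
have notinA S : S \in subtrees_in A -> b \notin S.
  rewrite inE => /andP[_ /subsetP sSA]; apply/negP => /sSA.
  by rewrite (disjointFl disAB).
have notinB S : S \in subtrees_in B -> a \notin S.
  rewrite inE => /andP[_ /subsetP sSB]; apply/negP => /sSB.
  by rewrite (disjointFr disAB).
split.
  rewrite -(cardsUI (subtrees_in A)).
  have -> : subtrees_in A :&: subtrees_in B = set0.
    apply/setP => S; rewrite in_set0 inE; apply/negP => /andP[].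
    rewrite !inE => /andP[conS sSA] /andP[_ sSB].
    have /set0Pn[x xS] := connected_set_neq0 conS.
    by move: (subsetP sSB x xS); rewrite (disjointFr disAB) // (subsetP sSA).
  rewrite cards0 addn0 -cardsUI -[LHS]addn0; congr (_ + _).
    apply: eq_card => S; rewrite (mem_subtrees_join _ joinAB).
    by rewrite !in_setU orbA.
  apply/esym/eqP; rewrite cards_eq0; apply/eqP/setP => S.
  rewrite in_set0 in_setI; apply/negP => /andP[SAB /cross[aS bS]].
  case/setUP: SAB => [/notinA|/notinB].
    by rewrite bS.
  by rewrite aS.
rewrite -cardsUI -[LHS]addn0; congr (_ + _).
  apply: eq_card => S.
  rewrite [LHS]inE (mem_subtrees_join _ joinAB) [RHS]in_setU.
  rewrite [S \in subtrees_at _ _]inE.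
  have [/cross[-> _]|_] := boolP (S \in crossing_subtrees _ _ _ _).
    by rewrite !orbT.
  rewrite !orbF; have [/notinB/negPf->|] := boolP (S \in subtrees_in B).
    by rewrite !andbF.
  by rewrite orbF.
apply/esym/eqP; rewrite cards_eq0; apply/eqP/setP => S; rewrite in_set0 in_setI.
by rewrite inE; apply/negP => /andP[/andP[/notinA/negP bS _] /cross[_]].
Qed.

Lemma realizes_counts (G : sgraph) t (A : {set G}) a : realizes t A a ->
  #|subtrees_in A| = subtrees t /\ #|subtrees_at A a| = rooted_subtrees t.
Proof.
elim: t A a => [|s IHs u IHu] A a /=; last first.
  case=> B [C [b [-> join /IHs[<- <-] /IHu[<- <-]]]].
  exact: card_subtrees_join join.
move=> ->; rewrite -!(cards1 [set a]).
have con1 : connected_set [set a].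
  by apply/(connected_setP (set11 a)) => X aX _; rewrite sub1set.
have in1 S : (S \in subtrees_in [set a]) = (S == [set a]).
  rewrite inE subset1; have [->|_] := eqVneq S; first by rewrite con1.
  by apply/negP => /andP[/connected_set_neq0/negP].
split; apply: eq_card => S; rewrite [RHS]inE ?in1 //.
by rewrite inE in1; have [->|//] := eqVneq S; rewrite set11.
Qed.

Lemma num_subtrees_realizes (G : sgraph) t (a : G) :
  realizes t [set: G] a -> num_subtrees G = subtrees t.
Proof.
move=> /realizes_counts[<- _]; apply: eq_card => S.
by rewrite !inE subsetT andbT.
Qed.

(** * Degrees in a decomposed graph *)

Lemma card_root_nbrs (G : sgraph) t (A : {set G}) a :
  realizes t A a -> #|[set y in A | adj a y]| = root_degree t.
Proof.
elim: t A a => [|s IHs u _] A a /= => [->|[B [C [b [-> joinBC /IHs <- uC]]]]].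
  apply/eqP; rewrite cards_eq0; apply/eqP/setP => y; rewrite !inE.
  by case: eqP => // ->; rewrite adj_irr.
have [disBC aB bC adjBC] := joinBC.
have b_new : b \notin [set y in B | adj a y].
  by rewrite inE (disjointFl disBC).
have := cardsU1 b [set y in B | adj a y].
rewrite b_new add1n => <-; apply: eq_card => y; rewrite !inE.
have [yB|yB] := boolP (y \in B).
  rewrite /= (negPf (_ : y != b)) //.
  by apply: contraTneq yB => ->; rewrite (disjointFl disBC).
rewrite orbF; have [yC|yC] := boolP (y \in C); first by rewrite adjBC // eqxx.
by apply/esym/negbTE; apply: contraNneq yC => ->.
Qed.

(** Only the root has neighbours outside of A, so the other vertices of A have
    the same degree in A as in G. *)
Definition branch (G : sgraph) (A : {set G}) a : Prop :=
  forall x y, x \in A -> x != a -> adj x y -> y \in A.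

Lemma branch_edge_join (G : sgraph) (A B : {set G}) a b :
  edge_join A a B b -> branch (A :|: B) a -> branch A a /\ branch B b.
Proof.
move=> [disAB aA bB adjAB] brAB.
split=> x y; [move=> xA x_a xy | move=> xB x_b xy].
  have := brAB x y; rewrite !inE xA => /(_ isT x_a xy)/orP[//|yB].
  by rewrite adjAB // (negPf x_a) in xy.
have x_a : x != a by apply: contraTneq xB => ->; rewrite (disjointFr disAB).
have := brAB x y; rewrite !inE xB orbT => /(_ isT x_a xy)/orP[yA|//].
by rewrite adj_sym adjAB // (negPf x_b) andbF in xy.
Qed.

Lemma realizes_ary_below (G : sgraph) d t (A : {set G}) a :
    (forall x : G, ~~ leaf x -> degree x = d.+1) ->
    realizes t A a -> branch A a ->
  ary_below d t /\ inner_below t = #|[set x in A | (x != a) && ~~ leaf x]|.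
Proof.
move=> degG; elim: t A a => [|s IHs u IHu] A a /=.
  move=> -> _; split=> //.
  apply/esym/eqP; rewrite cards_eq0; apply/eqP/setP => y.
  by rewrite !inE; case: eqP.
case=> B [C [b [-> joinBC sB uC]]] brBC.
have [brB brC] := branch_edge_join joinBC brBC.
have [-> ->] := IHs B a sB brB; have [-> ->] := IHu C b uC brC.
have [disBC aB bC adjBC] := joinBC.
have C_neq_a x : x \in C -> x != a.
  by apply: contraTneq => ->; rewrite (disjointFr disBC).
have deg_b : degree b = (root_degree u).+1.
  have a_new : a \notin [set y in C | adj b y].
    by rewrite inE (disjointFr disBC).
  rewrite -(card_root_nbrs uC); have := cardsU1 a [set y in C | adj b y].
  rewrite a_new add1n => <-; apply: eq_card => y; rewrite !inE.
  apply/idP/orP => [b_y|[/eqP->|/andP[]//]]; last first.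
    by rewrite adj_sym adjBC // !eqxx.
  have := brBC b y; rewrite !inE bC orbT C_neq_a //.
  case/(_ isT isT b_y)/orP=> [yB|yC].
    by left; move: b_y; rewrite adj_sym adjBC // => /andP[].
  by right; rewrite yC.
have leaf_b : leaf b = (root_degree u == 0) by rewrite /leaf deg_b eqSS.
split.
  case: (altP (root_degree u =P 0)) => //=; rewrite -leaf_b => /degG.
  by rewrite deg_b => -[->].
pose X := [set x in B | (x != a) && ~~ leaf x].
pose Y := [set x in C | ~~ leaf x].
have -> : [set x in B :|: C | (x != a) && ~~ leaf x] = X :|: Y.
  apply/setP => x; rewrite !inE; have [/C_neq_a->|_] := boolP (x \in C).
    by case: (x \in B); rewrite ?orbb.
  by rewrite !orbF.
rewrite cardsU (_ : X :&: Y = set0) ?cards0 ?subn0; last first.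
  apply/setP => x; rewrite !inE; have [xB|//] := boolP (x \in B).
  by rewrite (disjointFr disBC) // andbF.
rewrite (cardsD1 b Y) [b \in Y]inE bC -leaf_b -addnA [_ + (~~ _)]addnC.
by congr (_ + (_ + _)); apply: eq_card => x; rewrite !inE andbCA.
Qed.

(** A non-leaf is taken as the root a, so that it has d + 1 children; splitting
    off the last one leaves a with d children in s. *)
Lemma qary_realizes n d (T : sgraph) : 0 < n -> qary_class n d.+1 T ->
  exists s u (a : T), [/\ realizes (Graft s u) [set: T] a, ary_below d s,
    root_degree s = d, ary d u & inner s + inner u = n].
Proof.
move=> n_gt0 [[[conT acyT] degT] card_n].
have [a] : exists a, a \in [set x : T | ~~ leaf x].
  by apply/set0Pn; rewrite -card_gt0 card_n.
rewrite inE => inner_a.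
have [t tT] := realizes_of_tree acyT conT (in_setT a).
have brT : branch [set: T] a by move=> *; rewrite inE.
have [below_t] := realizes_ary_below degT tT brT.
have := card_root_nbrs tT.
rewrite (_ : [set y in [set: T] | adj a y] = [set y | adj a y]); last first.
  by apply/setP => y; rewrite !inE.
rewrite -/(degree a) (degT a inner_a).
case: t tT below_t => //= s u tT /and3P[below_s below_u rd_u] [rd_s] card_t.
exists s, u, a; split=> //; first by rewrite /ary below_u.
have d_gt0 : 0 < d.
  by move: (inner_a); rewrite /leaf (degT a inner_a) eqSS -lt0n.
rewrite -card_n (cardsD1 a) inE inner_a /inner -rd_s -lt0n d_gt0 addnAC addnA.
rewrite card_t [RHS]addnC; congr (_ + _); apply: eq_card => x.
by rewrite !inE.
Qed.

(** * Terms determine trees *)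

(** Every vertex of a cycle has two neighbours on it, whereas the first claim
    shows that a nonempty vertex set with this property, even with an exception
    at the root, cannot go beyond the root: by induction it has at most the
    vertex b in the part grafted along ab, and a is then the only candidate for
    a neighbour of b. *)
Lemma realizes_acyclic (G : sgraph) t (a : G) :
  realizes t [set: G] a -> acyclic G.
Proof.
have core (A X : {set G}) : realizes t A a -> X \subset A ->
    {in X, forall x, x != a -> 1 < #|[set y in X | adj x y]|} ->
    X \subset [set a].
  elim: t A a X => [|s IHs u IHu] A {}a X /=; first by move=> ->.
  case=> B [C [b [-> joinBC sB uC]]] sXBC X2.
  have [disBC aB bC adjBC] := joinBC.
  have XB : X :&: B \subset [set a].
    apply: IHs sB _ _; rewrite ?subsetIr // => x /setIP[xX xB] x_a.
    rewrite (leq_trans (X2 x xX x_a)) //; apply/subset_leq_card/subsetP => y.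
    rewrite !inE => /andP[yX xy]; rewrite yX xy !andbT.
    have := subsetP sXBC y yX => /setUP[//|yC].
    by rewrite adjBC // (negPf x_a) in xy.
  have XC : X :&: C \subset [set b].
    apply: IHu uC _ _; rewrite ?subsetIr // => x /setIP[xX xC] x_b.
    have x_a : x != a by apply: contraTneq xC => ->; rewrite (disjointFr disBC).
    rewrite (leq_trans (X2 x xX x_a)) //; apply/subset_leq_card/subsetP => y.
    rewrite !inE => /andP[yX xy]; rewrite yX xy !andbT.
    have := subsetP sXBC y yX => /setUP[yB|//].
    by rewrite adj_sym adjBC // (negPf x_b) andbF in xy.
  apply/subsetP => x xX; have := subsetP sXBC x xX => /setUP[xB|xC].
    by apply: (subsetP XB); rewrite inE xX.
  have x_b : x = b by apply/set1P/(subsetP XC); rewrite inE xX.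
  have x_a : x != a by apply: contraTneq xC => ->; rewrite (disjointFr disBC).
  have := X2 x xX x_a; rewrite ltnNge => /negP[].
  rewrite -(cards1 a); apply/subset_leq_card/subsetP => y.
  rewrite !inE => /andP[yX].
  have := subsetP sXBC y yX => /setUP[yB|yC].
    by rewrite adj_sym adjBC // x_b eqxx andbT.
  have -> : y = b by apply/set1P/(subsetP XC); rewrite inE yX.
  by rewrite x_b adj_irr.
move=> shT c /andP[cyc_c uniq_c]; rewrite leqNgt; apply/negP => c3.
have /subset_leq_card : [set x in c] \subset [set a].
  apply: core shT (subsetT _) _ => x; rewrite inE => xc _.
  (* Rotated to start at x, the cycle has the neighbours of x at its second and
     last positions; they differ since its length is at least 3. *)
  have [i [|y [|z p]] def_c] := rot_to xc;
    try by move: c3; rewrite -(size_rot i) def_c.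
  have := uniq_c; rewrite -(rot_uniq i) def_c !cons_uniq => /and3P[_ y_zp _].
  move: cyc_c; rewrite -(rot_cycle i) def_c /= => /and3P[xy yz].
  rewrite rcons_path => /andP[_ lx].
  have y_l : y != last z p by apply: contraNneq y_zp => ->; apply: mem_last.
  have := cards2 y (last z p); rewrite y_l => <-.
  have in_c w : w \in [:: x, y, z & p] -> w \in c by rewrite -def_c mem_rot.
  apply/subset_leq_card/subsetP => w; rewrite !inE => /orP[]/eqP->.
    by rewrite xy in_c // !inE eqxx orbT.
  by rewrite adj_sym lx in_c // in_cons in_cons mem_last !orbT.
by rewrite cards1 leqNgt cardsE (card_uniqP uniq_c) (ltn_trans _ c3).
Qed.

Lemma realizes_connected (G : sgraph) t (A : {set G}) a :
  realizes t A a -> connected_set A.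
Proof.
elim: t A a => [|s IHs u IHu] A a /=.
  by move=> ->; apply/(connected_setP (set11 a)) => X aX _; rewrite sub1set.
case=> B [C [b [-> joinBC /IHs conB /IHu conC]]].
have [_ aB bC _] := joinBC.
by rewrite (connected_edge_join joinBC) ?connected_set_neq0 // aB bC conB.
Qed.

Lemma realizes_is_tree (G : sgraph) t (a : G) :
  realizes t [set: G] a -> is_tree G.
Proof.
move=> shG.
by split; [apply: realizes_connected shG | apply: realizes_acyclic shG].
Qed.

Lemma realizes_imset (G H : sgraph) (f : G -> H) t (A : {set G}) a :
  injective f -> (forall x y, adj (f x) (f y) = adj x y) ->
  realizes t A a -> realizes t (f @: A) (f a).
Proof.
move=> f_inj f_adj; elim: t A a => [|s IHs u IHu] A a /=.
  by move=> ->; rewrite imset_set1.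
case=> B [C [b [-> [disBC aB bC adjBC] sB uC]]].
exists (f @: B), (f @: C), (f b).
split; [exact: imsetU| |exact: IHs|exact: IHu]; split; rewrite ?imset_f //.
  apply/pred0P => z /=.
  apply/andP => -[/imsetP[x xB ->] /imsetP[y yC /f_inj xy]].
  by rewrite xy (disjointFl disBC) in xB.
move=> _ _ /imsetP[x xB ->] /imsetP[y yC ->].
by rewrite f_adj adjBC // !(inj_eq f_inj).
Qed.

Lemma iso_num_subtrees (G H : sgraph) t (a : G) :
  sgraph_iso G H -> realizes t [set: G] a -> num_subtrees G = num_subtrees H.
Proof.
case=> f f_bij f_adj shG; rewrite (num_subtrees_realizes shG).
have := realizes_imset (bij_inj f_bij) f_adj shG.
have -> : f @: [set: G] = [set: H].
  apply/setP => y; have [g _ fK] := f_bij; rewrite -(fK y) imset_f ?inE //.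
by move/num_subtrees_realizes.
Qed.

(** Isomorphisms between the parts send the ends of the joining edge in one graph
    to those in the other, so they glue to an isomorphism of the unions. *)
Lemma realizes_partial_iso (G H : sgraph) t (A : {set G}) a (B : {set H}) b :
  realizes t A a -> realizes t B b ->
  exists f : G -> H, [/\ f a = b, {in A, forall x, f x \in B},
    {in A &, injective f}, B \subset f @: A &
    {in A &, forall x y, adj (f x) (f y) = adj x y}].
Proof.
elim: t A a B b => [|s IHs u IHu] A a B b /=.
  move=> -> ->; exists (fun=> b); split=> //.
  - by move=> x _; rewrite set11.
  - by move=> x y /set1P-> /set1P->.
  - by rewrite imset_set1.
  by move=> x y /set1P-> /set1P->; rewrite !adj_irr.
case=> A1 [A2 [a2 [-> [disA aA1 a2A2 adjA] sA uA]]].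
case=> B1 [B2 [b2 [-> [disB bB1 b2B2 adjB] sB uB]]].
have [f [fa fB f_inj fA f_adj]] := IHs _ _ _ _ sA sB.
have [g [ga gB g_inj gA g_adj]] := IHu _ _ _ _ uA uB.
pose h x := if x \in A1 then f x else g x.
have hf x : x \in A1 -> h x = f x by rewrite /h => ->.
have hg x : x \in A2 -> h x = g x by move=> xA; rewrite /h (disjointFl disA).
have cross x y : x \in A1 -> y \in A2 -> adj (h x) (h y) = adj x y.
  move=> x1 y2; rewrite hf // hg // adjA // adjB ?fB ?gB //.
  by rewrite -fa -ga (inj_in_eq f_inj) // (inj_in_eq g_inj).
have apart x y : x \in A1 -> y \in A2 -> h x <> h y.
  move=> x1 y2; rewrite hf // hg // => fgxy.
  by have := fB x x1; rewrite fgxy (disjointFl disB) // gB.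
exists h; split; first by rewrite hf.
- by move=> x /setUP[] xA; rewrite inE ?(hf x xA) ?(hg x xA) ?fB ?gB ?orbT.
- move=> x y /setUP[] xA /setUP[] yA.
  + by rewrite !hf //; apply: f_inj.
  + by move/(apart _ _ xA yA).
  + by move/esym/(apart _ _ yA xA).
  by rewrite !hg //; apply: g_inj.
- apply/subsetP => z /setUP[/(subsetP fA)|/(subsetP gA)] /imsetP[x xA ->].
    by rewrite -hf // imset_f // inE xA.
  by rewrite -hg // imset_f // inE xA orbT.
move=> x y /setUP[] xA /setUP[] yA.
- by rewrite !hf ?f_adj.
- exact: cross.
- by rewrite adj_sym cross // adj_sym.
by rewrite !hg ?g_adj.
Qed.

Lemma realizes_iso (G H : sgraph) t (a : G) (b : H) :
  realizes t [set: G] a -> realizes t [set: H] b -> sgraph_iso G H.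
Proof.
move=> shG shH.
have [f [_ _ f_inj f_surj f_adj]] := realizes_partial_iso shG shH.
exists f; last by move=> x y; apply: f_adj; rewrite inE.
apply: inj_card_bij => [x y|]; first by apply: f_inj; rewrite inE.
rewrite -!cardsT; apply: leq_trans (subset_leq_card f_surj) _.
exact: leq_imset_card.
Qed.

(** * The caterpillar *)

Lemma realizes_star (G : sgraph) a (L : {set G}) : a \notin L ->
  {in L, forall x, adj a x} -> {in L &, forall x y, ~~ adj x y} ->
  realizes (star #|L|) (a |: L) a.
Proof.
have [k] := ubnP #|L|; elim: k L => // k IH L leLk aL adjL indL.
have [->|[x xL]] := set_0Vmem L; first by rewrite cards0 setU0.
rewrite (cardsD1 x L) xL add1n /=.
exists (a |: L :\ x), [set x], x; split=> //.
- by rewrite -setUA [_ :\ x :|: _]setUC setD1K.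
- split; rewrite ?set11 ?setU11 //.
    rewrite disjoint_sym disjoints1 !inE eqxx orbF.
    by apply: contraNneq aL => <-.
  move=> y _ /setU1P[->|/setD1P[_ yL]] /set1P->; first by rewrite adjL ?eqxx.
  rewrite (negPf (indL y x yL xL)) eqxx andbT.
  by apply/esym/negbTE; apply: contraNneq aL => <-.
apply: IH => [||y /setD1P[_ /adjL]|y z /setD1P[_ yL] /setD1P[_ zL]] //.
- by move: leLk; rewrite ltnS (cardsD1 x L) xL.
- by rewrite !inE (negPf aL) andbF.
exact: indL.
Qed.

Lemma eq_inlE n q (i j : 'I_n.+2) :
  (inl i == inl j :> caterpillar n q) = (i == j :> nat).
Proof. by []. Qed.

Lemma eq_inl_inrE n q (i : 'I_n.+2) p :
  (inl i == inr p :> caterpillar n q) = false.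
Proof. by []. Qed.

Lemma eq_inr_inlE n q (i : 'I_n.+2) p :
  (inr p == inl i :> caterpillar n q) = false.
Proof. by []. Qed.

Definition pendants n q (k : 'I_n) : {set caterpillar n q} :=
  [set inr (k, j) | j : 'I_(q - 2)].

Lemma card_pendants n q (k : 'I_n) : #|pendants q k| = q - 2.
Proof. by rewrite card_imset ?card_ord // => i j []. Qed.

Lemma inl_in_pendants n q (k : 'I_n) i :
  ((inl i : caterpillar n q) \in pendants q k) = false.
Proof. by apply/imsetP => -[]. Qed.

Lemma inr_in_pendants n q (k l : 'I_n) j :
  ((inr (l, j) : caterpillar n q) \in pendants q k) = (l == k).
Proof.
apply/imsetP/eqP => [[j' _ [->]] // | ->]; by exists j.
Qed.

Definition tail_from n q i : {set caterpillar n q} :=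
  [set x : 'I_n.+2 + 'I_n * 'I_(q - 2) |
     match x with inl j => i <= j | inr (k, _) => i <= k.+1 end].

Lemma in_tail n q i (x : caterpillar n q) :
  (x \in tail_from n q i) =
    match x with inl j => i <= j | inr (k, _) => i <= k.+1 end.
Proof. by rewrite inE. Qed.

Definition in_caterpillar :=
  (eq_inlE, eq_inl_inrE, eq_inr_inlE, inr_in_pendants, inl_in_pendants, in_tail,
   in_setU1, in_set1, in_setU, in_setT).

(** From right to left along the spine: a spine vertex and its pendant vertices
    form a star, and the next tail is grafted on its centre. *)
Lemma caterpillar_tail n q m (i : 'I_n.+2) : m + i = n.+1 -> 0 < i ->
  realizes (comb q.-1 m) (tail_from n q i) (inl i).
Proof.
elim: m i => [|m IH] i /= eq_i i_gt0.
  apply/setP => -[j|[k j]]; rewrite !in_caterpillar.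
    by have := ltn_ord j; lia.
  by have := ltn_ord k; lia.
have lt_k : i.-1 < n by lia.
have lt_i : i.+1 < n.+2 by lia.
pose k := Ordinal lt_k; pose i' := Ordinal lt_i.
exists (inl i |: pendants q k), (tail_from n q i'), (inl i'); split.
- apply/setP => -[j|[l j]]; rewrite !in_caterpillar -?val_eqE /=; lia.
- split; rewrite ?in_caterpillar //=.
  + apply/pred0P => -[j|[l j]] /=; rewrite !in_caterpillar -?val_eqE /=; lia.
  + by rewrite eqxx.
  + move=> [j|[l j]] [j'|[l' j']]; rewrite !in_caterpillar -?val_eqE /= => *; lia.
- rewrite (_ : q.-1.-1 = #|pendants q k|); last by rewrite card_pendants; lia.
  apply: realizes_star; first by rewrite in_caterpillar.
    by move=> _ /imsetP[j _ ->] /=; lia.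
  by move=> _ _ /imsetP[j _ ->] /imsetP[j' _ ->].
by apply: IH => //=; lia.
Qed.

Lemma caterpillar_realizes n q :
  realizes (Graft Single (comb q.-1 n)) [set: caterpillar n q] (inl ord0).
Proof.
pose i := lift ord0 (ord0 : 'I_n.+1).
exists [set inl ord0], (tail_from n q i), (inl i); split=> //; last first.
- by apply: caterpillar_tail => //=; rewrite /bump /=; lia.
- split; rewrite ?in_caterpillar //=.
    by rewrite disjoints1 in_caterpillar.
  move=> _ [j|[k j]] /set1P->; rewrite !in_caterpillar /= /bump /=; lia.
by apply/setP => -[j|[k j]]; rewrite !in_caterpillar /= /bump /=; lia.
Qed.

Lemma caterpillar_degree n q (x : caterpillar n q) : 2 <= q ->
  degree x = if x is inl i then if (0 < i) && (i <= n) then q else 1 else 1.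
Proof.
move=> q2; case: x => [i|[k j]]; last first.
  have lt_k : k.+1 < n.+2 by have := ltn_ord k; lia.
  apply: etrans (cards1 (inl (Ordinal lt_k) : caterpillar n q)); apply: eq_card.
  by move=> -[i'|[k' j']]; rewrite in_set in_caterpillar.
case: ifP => [|i_end].
  move=> i_mid; have lt_k : i.-1 < n by lia.
  pose k := Ordinal lt_k.
  have lt1 : i.-1 < n.+2 by lia.
  have lt2 : i.+1 < n.+2 by lia.
  pose i1 : caterpillar n q := inl (Ordinal lt1).
  pose i2 : caterpillar n q := inl (Ordinal lt2).
  have card_nbrs : #|i1 |: (i2 |: pendants q k)| = q.
    rewrite !cardsU1 card_pendants !in_caterpillar /=; lia.
  apply: etrans card_nbrs; apply: eq_card => -[i'|[k' j']];
    rewrite in_set !in_caterpillar -?val_eqE /=; lia.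
(* The neighbour of an end of the spine: 1 for the left end, n for the right. *)
have lt1 : (if i == 0 :> nat then 1 else n) < n.+2 by case: ifP.
apply: etrans (cards1 (inl (Ordinal lt1) : caterpillar n q)); apply: eq_card.
move=> -[i'|[k' j']]; rewrite in_set !in_caterpillar /=; have := ltn_ord i.
  have := ltn_ord i'; case: ifP; lia.
have := ltn_ord k'; lia.
Qed.

Lemma caterpillar_class n q : 2 <= q -> qary_class n q (caterpillar n q).
Proof.
move=> q2; split; first split.
- exact: realizes_is_tree (caterpillar_realizes n q).
- by move=> x; rewrite /leaf caterpillar_degree //; case: x => [i|//]; case: ifP.
have lt_k (k : 'I_n) : k.+1 < n.+2 by have := ltn_ord k; lia.
pose spine k : caterpillar n q := inl (Ordinal (lt_k k)).
rewrite -[RHS]card_ord -(@card_imset _ _ spine xpredT).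
  apply: eq_card => x; rewrite inE /leaf caterpillar_degree //.
  apply/idP/imsetP => [|[k _ ->] /=]; last by have := ltn_ord k; case: ifP; lia.
  case: x => // i; case: ifP => // i_mid _.
  have lt_i : i.-1 < n by lia.
  by exists (Ordinal lt_i) => //; congr inl; apply: val_inj => /=; lia.
by move=> k l [] /val_inj.
Qed.

Lemma caterpillar_num_subtrees n q :
  num_subtrees (caterpillar n q) = subtrees (Graft Single (comb q.-1 n)).
Proof. exact: num_subtrees_realizes (caterpillar_realizes n q). Qed.

Lemma subtrees_combS d m :
  subtrees (comb d m.+1) =
    2 ^ d.-1 + d.-1 + subtrees (comb d m)
      + 2 ^ d.-1 * rooted_subtrees (comb d m).
Proof. by rewrite /= subtrees_star rooted_subtrees_star. Qed.

Section Formula.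
Import GRing.Theory Num.Theory Order.TTheory.
Local Open Scope ring_scope.

(** With p = 2^(q-2), the number N of subtrees through the root of a comb
    satisfies N_(m+1) = p (N_m + 1), whose fixed point is -p / (p - 1); summing
    the resulting geometric progression over the spine gives the formula. *)
Lemma comb_subtrees_formula n q : (3 <= q)%N -> (0 < n)%N ->
  (subtrees (Graft Single (comb q.-1 n)))%:R =
         2 ^+ (q - 2) * (2 ^+ (q - 1) - 1) ^+ 2
           * (2 ^+ ((n - 1) * (q - 2)) - 1) / (2 ^+ (q - 2) - 1) ^+ 2
         - (n%:R - 1) / (2 ^+ (q - 2) - 1)
         + 2 ^+ q + n%:R * q%:R - 3 * n%:R + 3 :> rat.
Proof.
case: q => [|[|r]] // r_gt0; case: n => // n _.
rewrite !subSS !subn0 mulnC exprM [2 ^+ r.+2]exprS [2 ^+ r.+1]exprS.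
have p_gt1 : (1 : rat) < 2 ^+ r by rewrite exprn_egt1 // -lt0n.
set p : rat := 2 ^+ r in p_gt1 *.
have p1 : p - 1 != 0 by rewrite subr_eq0 gt_eqF.
have ep : (2 ^ r)%:R = p by rewrite natrX.
have N_formula m : (rooted_subtrees (comb r.+1 m))%:R
     = p ^+ m * (2 * p - 1) / (p - 1) - p / (p - 1).
  elim: m => [|m IH] /=; first by rewrite expr0; field.
  rewrite rooted_subtrees_star natrM -natr1 IH ep exprSr; field.
  exact: p1.
have subtrees_step m : (subtrees (comb r.+1 m.+1))%:R =
    p + r%:R + (subtrees (comb r.+1 m))%:R
      + p * (rooted_subtrees (comb r.+1 m))%:R.
  rewrite subtrees_combS; move: (subtrees _) (rooted_subtrees _) => a b.
  by rewrite !natrD natrM ep.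
have F_formula m : (subtrees (comb r.+1 m.+1))%:R
     = p * (2 * p - 1) ^+ 2 * (p ^+ m - 1) / (p - 1) ^+ 2 - m%:R / (p - 1)
       + 4 * p + (m%:R + 1) * (r%:R + 2) - 3 * (m%:R + 1) + 2
       - (rooted_subtrees (comb r.+1 m.+1))%:R :> rat.
  elim: m => [|m IH]; rewrite subtrees_step.
    rewrite !N_formula expr0 expr1; field.
    exact: p1.
  rewrite IH !N_formula -natr1 !exprSr; field.
  exact: p1.
have -> : subtrees (Graft Single (comb r.+1 n.+1)) =
    (1 + subtrees (comb r.+1 n.+1) + rooted_subtrees (comb r.+1 n.+1))%N.
  by rewrite -[in RHS](mul1n (rooted_subtrees _)).
rewrite natrD natrD F_formula -!natr1; field.
exact: p1.
Qed.
End Formula.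

(** * Minimality *)

(** Equality makes the realizing term of T equivalent to that of the
    caterpillar, and realizing a common term is what provides the isomorphism. *)
Lemma qary_min n q (T : sgraph) :
  1 <= n -> 2 <= q -> qary_class n q T ->
  num_subtrees (caterpillar n q) <= num_subtrees T /\
  (num_subtrees T = num_subtrees (caterpillar n q) ->
   sgraph_iso T (caterpillar n q)).
Proof.
case: n q => [|m] [|[|d']] // _ _; set d := d'.+1 => T_class.
have d_gt0 : 0 < d by [].
have [s [u [a [suT below_s rd_s ary_u]]]] := qary_realizes (ltn0Sn m) T_class.
have [v rv [ary_v <-]] := reroot_star d_gt0 below_s rd_s ary_u.
case=> inner_v; have [b vT] := realizes_reroot rv suT.
have rc := comb_reroot m d_gt0.
rewrite (num_subtrees_realizes vT) caterpillar_num_subtrees.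
rewrite -(reroot_subtrees rc).
have [le_v eq_v] := star_extremal d_gt0 ary_v; rewrite inner_v in le_v eq_v.
split=> // /eq_v reorder_v.
have /realizes_reroot : reroot (Graft (star d) v) (Graft Single (comb d m.+1)).
  apply: reroot_trans rc; apply: reroot_reorder.
  exact: reorder_graft (reorder_refl _) reorder_v.
by case/(_ _ _ _ vT) => c /realizes_iso; apply; apply: caterpillar_realizes.
Qed.

Theorem theorem1p4 (n q : nat) (hn : 1 <= n) (hq : 2 <= q) :
  [/\ qary_class n q (caterpillar n q),
      forall T : sgraph, qary_class n q T ->
        num_subtrees (caterpillar n q) <= num_subtrees T /\
        (num_subtrees T = num_subtrees (caterpillar n q) <->
         sgraph_iso T (caterpillar n q))
    & 3 <= q ->
      ((num_subtrees (caterpillar n q))%:R =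
         2 ^+ (q - 2) * (2 ^+ (q - 1) - 1) ^+ 2
           * (2 ^+ ((n - 1) * (q - 2)) - 1) / (2 ^+ (q - 2) - 1) ^+ 2
         - (n%:R - 1) / (2 ^+ (q - 2) - 1)
         + 2 ^+ q + n%:R * q%:R - 3 * n%:R + 3 :> rat)%R].
Proof.
split; first exact: caterpillar_class.
  move=> T T_class; have [le_T eq_T] := qary_min hn hq T_class.
  split=> //; split=> // iso_T.
  have [[[conT acyT] _] _] := T_class.
  have /set0Pn[a aT] := connected_set_neq0 conT.
  have [t tT] := realizes_of_tree acyT conT aT.
  exact: iso_num_subtrees iso_T tT.
by move=> q_ge3; rewrite caterpillar_num_subtrees; apply: comb_subtrees_formula.
Qed.
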